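(* There is a universal constant $c>0$ such that the following holds. Let $\ell\ge2$, let $\kappa\in\mathbb{N}_+^\ell$ with $\kappa_1+\cdots+\kappa_\ell=n$, and let $f:\mathcal{U}_\kappa\to\{0,1\}$. Then $$\frac{1}{\binom n2}\sum_{\tau\in\mathrm{Trans}(n)}\frac{\mathrm{Inf}_\tau[f]}{\log_2(2/\mathrm{Inf}_\tau[f])}\ \ge\ c\cdot\varrho_\kappa\cdot\mathrm{Var}_{\pi_\kappa}[f],$$ where terms with $\mathrm{Inf}_\tau[f]=0$ are interpreted as $0$.
   Context: The multislice is $\mathcal{U}_\kappa=\{u\in[\ell]^n : u \text{ has exactly } \kappa_i \text{ coordinates equal to } i,\ \forall i\in[\ell]\}$, with uniform distribution $\pi_\kappa$. $S_n$ acts by $(u^\sigma)_j=u_{\sigma(j)}$; $\mathrm{Trans}(n)$ is the set of all $\binom n2$ transpositions in $S_n$. For $f:\mathcal{U}_\kappa\to\mathbb{R}$ and $\tau\in\mathrm{Trans}(n)$, $\mathrm{Inf}_\tau[f]=\tfrac12\mathbf{E}_{u\sim\pi_\kappa}[(f(u)-f(u^\tau))^2]$. A probability density is $\phi:\mathcal{U}_\kappa\to\mathbb{R}^{\ge0}$ with $\mathbf{E}_{\pi_\kappa}[\phi]=1$. The log-Sobolev constant $\varrho_\kappa$ is the largest constant such that $\mathbf{E}_{u\sim\pi_\kappa,\,\tau\sim\mathrm{Trans}(n)}(\sqrt{\phi(u)}-\sqrt{\phi(u^\tau)})^2\ge\varrho_\kappa\cdot\mathbf{E}_{\pi_\kappa}[\phi\ln\phi]$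 for all probability densities $\phi$ on $\mathcal{U}_\kappa$. *)

(* Defs.v *)
From mathcomp Require Import all_boot all_order all_algebra all_fingroup.
From mathcomp Require Import classical_sets reals exp.

Set Implicit Arguments.
Unset Strict Implicit.
Unset Printing Implicit Defensive.

Import Order.TTheory GRing.Theory Num.Theory.

Local Open Scope ring_scope.

(* The alphabet [l] = {1, ..., l} is rendered as 'I_l = {0, ..., l - 1}. *)
Definition multislice (n l : nat) (kappa : 'I_l -> nat) :
    {set {ffun 'I_n -> 'I_l}} :=
  [set u : {ffun 'I_n -> 'I_l} |
    [forall i, #|[set j | u j == i]| == kappa i]].

Notation U_ n kappa := {u | u \in multislice n kappa}.

Definition word_act (n l : nat) (u : {ffun 'I_n -> 'I_l}) (s : 'S_n) :
    {ffun 'I_n -> 'I_l} :=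
  [ffun j => u (s j)].

Lemma word_act_multislice (n l : nat) (kappa : 'I_l -> nat)
    (u : {ffun 'I_n -> 'I_l}) (s : 'S_n) :
  u \in multislice n kappa -> word_act u s \in multislice n kappa.
Proof.
rewrite !inE => /forallP Hu; apply/forallP => i; rewrite -(eqP (Hu i)).
rewrite -(card_preimset [set j | u j == i] (@perm_inj _ s)).
by apply/eqP/eq_card => j; rewrite !inE ffunE.
Qed.

Definition act (n l : nat) (kappa : 'I_l -> nat) (u : U_ n kappa) (s : 'S_n) :
    U_ n kappa :=
  exist _ (word_act (val u) s) (word_act_multislice s (valP u)).

Definition Trans (n : nat) : {set 'S_n} :=
  [set tau | [exists i, exists j, (i != j) && (tau == tperm i j)]].

Section Analytic.
Variable R : realType.

Definition expect (T : finType) (F : T -> R) : R := (\sum_x F x) / #|T|%:R.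

Definition expect_in (T : finType) (A : {set T}) (F : T -> R) : R :=
  (\sum_(x in A) F x) / #|A|%:R.

Definition variance (T : finType) (f : T -> R) : R :=
  expect (fun x => (f x - expect f) ^+ 2).

Definition log2 (x : R) : R := ln x / ln 2.

Section Multislice.
Variables (n l : nat) (kappa : 'I_l -> nat).

Definition influence (tau : 'S_n) (f : U_ n kappa -> R) : R :=
  2^-1 * expect (fun u => (f u - f (act u tau)) ^+ 2).

Definition density (phi : U_ n kappa -> R) : Prop :=
  (forall u, 0 <= phi u) /\ expect phi = 1.

(* The convention 0 ln 0 = 0 is automatic for phi u * ln (phi u). *)
Definition log_sobolev_ineq (r : R) : Prop :=
  forall phi : U_ n kappa -> R, density phi ->
    expect (fun u => expect_in (Trans n) (fun tau =>
      (Num.sqrt (phi u) - Num.sqrt (phi (act u tau))) ^+ 2))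
    >= r * expect (fun u => phi u * ln (phi u)).

(* When the multislice has at least two points the set below contains 0, is   *)
(* bounded above (a point mass has positive entropy) and is closed, so its    *)
(* supremum is its largest element.                                           *)
Definition log_sobolev : R := sup [set r | log_sobolev_ineq r]%classic.

End Multislice.
End Analytic.

Arguments log_sobolev R n {l} kappa.

(* Main.v *)
(* Write L for the generator u |-> E_tau[h(u) - h(u^tau)] of the random
   transposition walk. A log-Sobolev inequality implies a Poincare inequality,
   so L F = f - E f is solvable. With g = f - f^tau and h = F - F^tau, the
   relation L h = g holds because L commutes with the action of S_n
   (transpositions form a conjugacy class), and
   Var f = <f, L F> = 1/2 E_tau <g, h>.
   It remains to bound <g, h> = <h, L h> for each tau, which is a dual form of
   the log-Sobolev inequality applied to the {-1,0,1}-valued function g; no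
   semigroup or hypercontractivity is involved. *)
From HB Require Import structures.
Require Import Defs.
From mathcomp Require Import all_boot all_order all_algebra all_fingroup.
From mathcomp Require Import classical_sets reals exp.
From mathcomp Require Import sequences ring lra.

Set Implicit Arguments.
Unset Strict Implicit.
Unset Printing Implicit Defensive.

Import Order.TTheory GRing.Theory Num.Theory.
Local Open Scope ring_scope.

(** * Averages over finite types and sets *)

Section Expectation.
Variables (R : realType) (T : finType).
Implicit Types (F G : T -> R) (c : R).

Lemma eq_expect F G : F =1 G -> expect F = expect G.
Proof. by move=> FG; rewrite /expect (eq_bigr G). Qed.

Lemma expectD F G : expect (fun x => F x + G x) = expect F + expect G.
Proof. by rewrite /expect big_split mulrDl. Qed.

Lemma expectZ c F : expect (fun x => c * F x) = c * expect F.
Proof. by rewrite /expect -mulr_sumr mulrA. Qed.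

Lemma expectB F G : expect (fun x => F x - G x) = expect F - expect G.
Proof.
rewrite -[- expect G]mulN1r -expectZ -expectD.
by apply: eq_expect => x; rewrite mulN1r.
Qed.

Lemma expect_cst c : (0 < #|T|)%N -> expect (fun _ : T => c) = c.
Proof.
move=> T0; rewrite /expect sumr_const -[c *+ _]mulr_natr mulfK //.
by rewrite pnatr_eq0 -lt0n.
Qed.

Lemma expect_ge0 F : (forall x, 0 <= F x) -> 0 <= expect F.
Proof. by move=> F0; rewrite divr_ge0 ?ler0n // sumr_ge0. Qed.

Lemma le_expect F G : (forall x, F x <= G x) -> expect F <= expect G.
Proof.
by move=> FG; rewrite -subr_ge0 -expectB expect_ge0 // => x; rewrite subr_ge0.
Qed.

Lemma expect_reindex (s : T -> T) F :
  injective s -> expect (fun x => F (s x)) = expect F.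
Proof. by move=> s_inj; rewrite /expect [in RHS](reindex_inj s_inj). Qed.

Lemma expect_sqr_eq0 F : expect (fun x => F x ^+ 2) = 0 -> forall x, F x = 0.
Proof.
move=> /eqP; rewrite /expect mulf_eq0 invr_eq0 pnatr_eq0 => /orP[F0|T0] x.
  move: F0; rewrite psumr_eq0 => [/allP/(_ x)|y _]; last exact: sqr_ge0.
  by rewrite mem_index_enum sqrf_eq0 => /(_ isT)/eqP.
by have := card0_eq (eqP T0) x; rewrite inE.
Qed.

(** The nonnegative quantity E[(b F - p G)^2] expands to b (a b - p^2); if b = 0 then G vanishes. *)
Lemma Cauchy_Schwarz_expect F G :
  expect (fun x => F x * G x) ^+ 2 <=
  expect (fun x => F x ^+ 2) * expect (fun x => G x ^+ 2).
Proof.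
set p := expect (fun x => F x * G x).
set a := expect (fun x => F x ^+ 2); set b := expect (fun x => G x ^+ 2).
have b_ge0 : 0 <= b by apply: expect_ge0 => x; exact: sqr_ge0.
have [b0|b_neq0] := eqVneq b 0.
  have G0 := expect_sqr_eq0 b0.
  have -> : p = expect (fun x => 0 * F x).
    by apply: eq_expect => x; rewrite G0 mulr0 mul0r.
  by rewrite expectZ mul0r expr0n b0 mulr0.
have : 0 <= expect (fun x => (b * F x - p * G x) ^+ 2).
  by apply: expect_ge0 => x; exact: sqr_ge0.
have -> : expect (fun x => (b * F x - p * G x) ^+ 2) = b * (a * b - p ^+ 2).
  have -> : expect (fun x => (b * F x - p * G x) ^+ 2) =
    expect (fun x => b ^+ 2 * F x ^+ 2 + (p ^+ 2 * G x ^+ 2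
      - 2 * b * p * (F x * G x))) by apply: eq_expect => x; ring.
  by rewrite expectD expectB !expectZ -/a -/b -/p; ring.
by rewrite pmulr_rge0 ?lt_def ?b_neq0 // subr_ge0.
Qed.

Lemma variance_sqr F : (0 < #|T|)%N ->
  variance F = expect (fun x => F x ^+ 2) - expect F ^+ 2.
Proof.
move=> T0; rewrite /variance; set m := expect F.
have -> : expect (fun x => (F x - m) ^+ 2) =
  expect (fun x => F x ^+ 2 + (m ^+ 2 - 2 * m * F x)).
  by apply: eq_expect => x; ring.
by rewrite expectD expectB expectZ expect_cst // -/m; ring.
Qed.

Lemma expect_in_exchange (I : finType) (A : {set I}) (F : T -> I -> R) :
  expect (fun x => expect_in A (F x)) =
  expect_in A (fun i => expect (fun x => F x i)).
Proof.
rewrite /expect /expect_in -mulr_suml exchange_big -mulr_suml.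
by rewrite mulrAC.
Qed.

End Expectation.

Section ExpectationIn.
Variables (R : realType) (I : finType) (A : {set I}).
Implicit Types (F G : I -> R) (c : R).

Lemma eq_expect_in F G :
  (forall i, i \in A -> F i = G i) -> expect_in A F = expect_in A G.
Proof. by move=> FG; rewrite /expect_in (eq_bigr G). Qed.

Lemma expect_inD F G :
  expect_in A (fun i => F i + G i) = expect_in A F + expect_in A G.
Proof. by rewrite /expect_in big_split mulrDl. Qed.

Lemma expect_inZ c F : expect_in A (fun i => c * F i) = c * expect_in A F.
Proof. by rewrite /expect_in -mulr_sumr mulrA. Qed.

Lemma le_expect_in F G :
  (forall i, i \in A -> F i <= G i) -> expect_in A F <= expect_in A G.
Proof. by move=> FG; rewrite ler_wpM2r ?invr_ge0 ?ler0n // ler_sum. Qed.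

End ExpectationIn.

(** * Convexity inequalities for the entropy function *)

Section EntropyBounds.
Variable R : realType.
Implicit Types (x y : R).

Lemma ln_ge1BV x : 0 < x -> 1 - x^-1 <= ln x.
Proof.
move=> x0; have := @le_ln1Dx R (x^-1 - 1).
by rewrite addrCA subrr addr0 lnV ?posrE // ltrBrDr addNr invr_gt0 => /(_ x0);
  lra.
Qed.

(** Fenchel-Young inequality: exp is the convex conjugate of x ln x - x. For x > 0 it is 1 + z <=
    e^z at z = y - ln x. *)
Lemma Young_entropy x y : 0 <= x -> x * y - expR y + x <= x * ln x.
Proof.
rewrite le_eqVlt => /orP[/eqP<-|x0].
  by rewrite !mul0r addr0 add0r oppr_le0 expR_ge0.
have : 1 + (y - ln x) <= expR y / x.
  by rewrite (le_trans (expR_ge1Dx _)) // expRD expRN lnK ?posrE.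
rewrite ler_pdivlMr // => h.
by rewrite -subr_ge0; move: h; rewrite -subr_ge0; nra.
Qed.

End EntropyBounds.

(** * Injective endomorphisms in finite dimension *)

Section LinearAlgebra.
Variables (R : realType) (T : finType).

Lemma injective_linear_surj (L : {ffun T -> R^o} -> {ffun T -> R^o}) :
  linear L -> (forall F, L F = 0 -> F = 0) -> forall G, exists F, L F = G.
Proof.
move=> Llin L0 G.
pose L' : {linear {ffun T -> R^o} -> {ffun T -> R^o}} :=
  HB.pack L (GRing.isLinear.Build _ _ _ _ L Llin).
have ker0 : lker (linfun L') == 0%VS.
  apply/lker0P => F H; rewrite !lfunE /= => /eqP.
  by rewrite -subr_eq0 -(raddfB L') => /eqP/L0/eqP; rewrite subr_eq0 => /eqP.
by exists ((linfun L')^-1%VF G); have := lker0_lfunVK ker0 G; rewrite lfunE.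
Qed.

End LinearAlgebra.

(** * The conjugacy class of transpositions *)

Section Transpositions.
Variable n : nat.

Lemma TransP (s : 'S_n) :
  reflect (exists i j, i != j /\ s = tperm i j) (s \in Trans n).
Proof.
rewrite inE; apply: (iffP existsP) => [[i /existsP[j /andP[ij /eqP ->]]]|].
  by exists i, j.
by move=> [i [j [ij ->]]]; exists i; apply/existsP; exists j; rewrite ij eqxx.
Qed.

Lemma Trans_involutive (s : 'S_n) : s \in Trans n -> involutive s.
Proof. by case/TransP => i [j [_ ->]] k; rewrite tpermK. Qed.

Lemma TransJ (s t : 'S_n) : ((s ^ t)%g \in Trans n) = (s \in Trans n).
Proof.
have J (a b : 'S_n) : a \in Trans n -> (a ^ b)%g \in Trans n.
  case/TransP => i [j [ij ->]]; rewrite tpermJ; apply/TransP.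
  by exists (b i), (b j); rewrite (inj_eq perm_inj).
by apply/idP/idP => [/(J _ t^-1%g)|/J//]; rewrite conjgK.
Qed.

(** A transposition is determined by its support, and the supports are exactly the two-element
    sets. *)
Lemma card_Trans : #|Trans n| = 'C(n, 2).
Proof.
pose supp (s : 'S_n) := [set k | s k != k].
have suppE (i j : 'I_n) : i != j -> supp (tperm i j) = [set i; j].
  move=> ij; apply/setP => k; rewrite !inE; case: tpermP => [->|->|].
  - by rewrite eq_sym ij eqxx.
  - by rewrite ij eqxx orbT.
  - by move=> /eqP/negPf-> /eqP/negPf->; rewrite eqxx.
have supp_inj : {in Trans n &, injective supp}.
  move=> _ _ /TransP[i [j [ij ->]]] /TransP[k [m [km ->]]].
  rewrite !suppE // => /setP e.
  have := e i; have := e j; rewrite !inE !eqxx orbT /=.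
  move=> /esym/orP[/eqP jk|/eqP jm] /esym/orP[/eqP ik|/eqP im]; subst.
  - by rewrite eqxx in ij.
  - by rewrite tpermC.
  - by [].
  - by rewrite eqxx in ij.
rewrite -(card_in_imset supp_inj) -[in RHS](card_ord n) -card_draws.
apply: eq_card => A; rewrite !inE; apply/imsetP/cards2P.
  by move=> [_ /TransP[i [j [ij ->]]] ->]; exists i, j; rewrite ?suppE.
move=> [i [j [ij ->]]]; exists (tperm i j); rewrite ?suppE //.
by apply/TransP; exists i, j.
Qed.

End Transpositions.

Local Notation act := Defs.act.

(** * Generator and Dirichlet form of the random transposition walk *)

Section Laplacian.
Variables (R : realType) (n l : nat) (kappa : 'I_l -> nat).
Implicit Types (h g : U_ n kappa -> R) (u : U_ n kappa) (s t : 'S_n).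

Definition laplacian h u : R :=
  expect_in (Trans n) (fun t => h u - h (act u t)).

(** The energy of the log-Sobolev inequality with [h] in place of sqrt phi. Without a factor 1/2 it
    equals 2 <h, L h>. *)
Definition dirichlet h : R :=
  expect (fun u => expect_in (Trans n) (fun t => (h u - h (act u t)) ^+ 2)).

Lemma act_act u s t : act (act u s) t = act u (t * s)%g.
Proof. by apply: val_inj; apply/ffunP => j; rewrite !ffunE permM. Qed.

Lemma act1 u : act u 1%g = u.
Proof. by apply: val_inj; apply/ffunP => j; rewrite !ffunE perm1. Qed.

Lemma act_inj t : injective (fun u => act u t).
Proof.
move=> u v /= /(congr1 (fun w => act w t^-1%g)).
by rewrite !act_act mulVg !act1.
Qed.

Lemma act_involutive t : t \in Trans n -> involutive (fun u => act u t).
Proof.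
move=> /Trans_involutive tK u.
by apply: val_inj; apply/ffunP => j; rewrite !ffunE tK.
Qed.

(** Symmetrization: for each t, the substitution u -> u^t is an involution preserving the
    expectation and reversing the sign of g(u) - g(u^t). *)
Lemma expect_mul_laplacian h g :
  expect (fun u => h u * laplacian g u) =
  2^-1 * expect_in (Trans n) (fun t =>
    expect (fun u => (h u - h (act u t)) * (g u - g (act u t)))).
Proof.
rewrite -expect_inZ.
have -> : expect (fun u => h u * laplacian g u) = expect (fun u =>
    expect_in (Trans n) (fun t => h u * (g u - g (act u t)))).
  by apply: eq_expect => u; rewrite expect_inZ.
rewrite expect_in_exchange; apply: eq_expect_in => t tT.
set d := fun u => g u - g (act u t).
have -> : expect (fun u => (h u - h (act u t)) * d u) =
    expect (fun u => h u * d u) - expect (fun u => h (act u t) * d u).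
  by rewrite -expectB; apply: eq_expect => u; rewrite mulrBl.
rewrite -(expect_reindex (fun u => h (act u t) * d u) (@act_inj t)).
have -> : expect (fun u => h (act (act u t) t) * d (act u t)) =
    -1 * expect (fun u => h u * d u).
  rewrite -expectZ; apply: eq_expect => u.
  by rewrite /d (act_involutive tT); ring.
by field.
Qed.

Lemma dirichletE h : dirichlet h = 2 * expect (fun u => h u * laplacian h u).
Proof.
rewrite expect_mul_laplacian mulrA divff ?pnatr_eq0 // mul1r.
by rewrite /dirichlet expect_in_exchange.
Qed.

(** Replacing s by its conjugate s^t permutes the transpositions, and t * s^t = s * t. *)
Lemma laplacian_act h t u :
  laplacian (fun v => h (act v t)) u = laplacian h (act u t).
Proof.
rewrite /laplacian /expect_in; congr (_ / _).
rewrite (reindex_inj (conjg_inj t)).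
apply: eq_big => [s|s _]; first by rewrite TransJ.
by rewrite !act_act conjgE mulgA mulgA mulgV mul1g.
Qed.

Lemma expect_laplacian h : expect (laplacian h) = 0.
Proof.
rewrite /laplacian expect_in_exchange /expect_in big1 ?mul0r // => t _.
by rewrite expectB (expect_reindex h (@act_inj t)) subrr.
Qed.

Lemma dirichlet_ge0 h : 0 <= dirichlet h.
Proof.
apply: expect_ge0 => u; apply: divr_ge0; rewrite ?ler0n // sumr_ge0 // => t _.
exact: sqr_ge0.
Qed.

End Laplacian.

(** * Consequences of a log-Sobolev inequality with constant r > 0 *)

Section LogSobolev.
Variables (R : realType) (n l : nat) (kappa : 'I_l -> nat) (r : R).
Hypothesis r_gt0 : 0 < r.
Hypothesis LS : @log_sobolev_ineq R n l kappa r.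
Implicit Types (h g psi : U_ n kappa -> R) (u : U_ n kappa).

(** Homogeneous form for signed [h]: take the density h^2 / m, whose square root is |h| / sqrt m;
    passing from h to |h| does not increase the energy. *)
Lemma log_sobolev_sqr h (m := expect (fun u => h u ^+ 2)) :
  r * expect (fun u => h u ^+ 2 * ln (h u ^+ 2 / m)) <= dirichlet h.
Proof.
have m_ge0 : 0 <= m by apply: expect_ge0 => u; exact: sqr_ge0.
have [m0|m_neq0] := eqVneq m 0.
  have h0 := expect_sqr_eq0 m0.
  rewrite (eq_expect (G := fun _ => 0 * 0)) => [|u]; last first.
    by rewrite h0 expr0n !mul0r.
  by rewrite expectZ mul0r mulr0 dirichlet_ge0.
have m_gt0 : 0 < m by rewrite lt_def m_neq0.
pose phi u := m^-1 * h u ^+ 2.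
have phiD : density phi.
  split=> [u|]; first by rewrite mulr_ge0 ?invr_ge0 ?sqr_ge0.
  by rewrite expectZ mulVf.
have := LS phiD.
have -> : expect (fun u => phi u * ln (phi u)) =
    m^-1 * expect (fun u => h u ^+ 2 * ln (h u ^+ 2 / m)).
  rewrite -expectZ; apply: eq_expect => u.
  by rewrite /phi mulrA (mulrC m^-1 (_ ^+ 2)).
rewrite mulrCA -ler_pdivlMl ?invr_gt0 // invrK => /le_trans; apply.
rewrite -ler_pdivlMl // /dirichlet -expectZ; apply: le_expect => u.
rewrite -expect_inZ; apply: le_expect_in => t _.
have sqrt_phi v : Num.sqrt (phi v) = Num.sqrt m^-1 * `|h v|.
  by rewrite sqrtrM ?invr_ge0 // sqrtr_sqr.
rewrite !sqrt_phi -mulrBr exprMn sqr_sqrtr ?invr_ge0 //.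
rewrite ler_wpM2l ?invr_ge0 // -[X in _ <= X]real_normK ?num_real //.
by rewrite -[X in X <= _]real_normK ?num_real // lerXn2r
  ?nnegrE // ler_dist_dist.
Qed.

(** Dual form of the entropy bound: average Young's inequality at x = h^2 / m, y = psi, scaled by m.
    The terms m - m E[e^psi] cost at most m. *)
Lemma log_sobolev_Young h psi :
  expect (fun u => expR (psi u)) <= 2 ->
  r * (expect (fun u => h u ^+ 2 * psi u) - expect (fun u => h u ^+ 2)) <=
  dirichlet h.
Proof.
set m := expect (fun u => h u ^+ 2) => psi2.
have m_ge0 : 0 <= m by apply: expect_ge0 => u; exact: sqr_ge0.
apply: le_trans (log_sobolev_sqr h); rewrite -/m ler_pM2l //.
have [m0|m_neq0] := eqVneq m 0.
  have h0 := expect_sqr_eq0 m0.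
  rewrite m0 subr0; apply: le_expect => u.
  by rewrite h0 expr0n !mul0r.
have m_gt0 : 0 < m by rewrite lt_def m_neq0.
apply: (@le_trans _ _ (expect (fun u =>
  h u ^+ 2 * psi u + (h u ^+ 2 - m * expR (psi u))))).
  rewrite expectD expectB expectZ -/m.
  have : m * expect (fun u => expR (psi u)) <= m * 2 by rewrite ler_wpM2l.
  by lra.
apply: le_expect => u; set x := h u ^+ 2 / m.
have -> : h u ^+ 2 = m * x by rewrite mulrC divfK.
have /(@Young_entropy R _ (psi u)) : 0 <= x by rewrite divr_ge0 ?sqr_ge0.
by rewrite -subr_ge0 => /(mulr_ge0 m_ge0); lra.
Qed.

(** For v > 0 and q^2 = E[v^2], the bound ln x >= 1 - 1/x at x = v / q gives entropy of v^2 at least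
    2 q^2 - 2 q E[v], which exceeds Var v by (q - E[v])^2. *)
Lemma log_sobolev_Poincare h : r * variance h <= dirichlet h.
Proof.
have [T0|T_gt0] := posnP #|{: U_ n kappa}|.
  by rewrite /variance /expect T0 invr0 !mulr0 dirichlet_ge0.
(* Variance and Dirichlet form are invariant under adding constants, so [h]
   may be made positive. *)
pose c := 1 + \sum_u `|h u|; pose v u := h u + c.
have v_gt0 u : 0 < v u.
  rewrite /v /c (bigD1 u) //=.
  have : 0 <= \sum_(i | i != u) `|h i| by apply: sumr_ge0.
  by have := ler_norm (- h u); rewrite normrN; lra.
have -> : variance h = variance v.
  apply: eq_expect => u.
  by rewrite /v expectD expect_cst // opprD addrACA subrr addr0.
have -> : dirichlet h = dirichlet v.
  apply: eq_expect => u; apply: eq_expect_in => t _.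
  by rewrite /v opprD addrACA subrr addr0.
apply: le_trans (log_sobolev_sqr v); rewrite ler_pM2l // variance_sqr //.
set m := expect (fun u => v u ^+ 2).
have m_ge0 : 0 <= m by apply: expect_ge0 => u; exact: sqr_ge0.
have m_gt0 : 0 < m.
  rewrite lt_def m_ge0 andbT; apply/eqP => /expect_sqr_eq0 v0.
  move/card_gt0P: T_gt0 => [u _].
  by have := v_gt0 u; rewrite v0 ltxx.
pose q := Num.sqrt m.
have q_gt0 : 0 < q by rewrite sqrtr_gt0.
have qE : m = q ^+ 2 by rewrite sqr_sqrtr.
apply: (@le_trans _ _ (expect (fun u => 2 * v u ^+ 2 - 2 * q * v u))).
  rewrite expectB !expectZ -/m.
  by have := sqr_ge0 (q - expect v); rewrite qE; lra.
apply: le_expect => u.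
have := @ln_ge1BV R (v u / q) (divr_gt0 (v_gt0 u) q_gt0).
rewrite qE -expr_div_n lnXn ?divr_gt0 // -mulr_natr invf_div.
rewrite -subr_ge0 => /(mulr_ge0 (sqr_ge0 (v u))).
have -> : q / v u = q * v u / v u ^+ 2 by field; rewrite gt_eqF.
by rewrite mulrBr mulrBr mulr1 [_ * (_ / _)]mulrC divfK ?expf_neq0 ?gt_eqF //;
  lra.
Qed.

(** By Poincare a mean-zero function with zero Laplacian vanishes, so injectivity and finite
    dimension yield a solution. *)
Lemma Poisson_equation (f : U_ n kappa -> R) :
  exists F : U_ n kappa -> R, forall u, laplacian F u = f u - expect f.
Proof.
have [T0|T_gt0] := posnP #|{: U_ n kappa}|.
  by exists f => u; have := card0_eq T0 u; rewrite inE.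
(* Adding the expectation to the Laplacian removes the constants from its
   kernel. *)
pose L (F : {ffun U_ n kappa -> R^o}) : {ffun U_ n kappa -> R^o} :=
  [ffun u => laplacian F u + expect F].
have Llin : linear L.
  move=> c F G; apply/ffunP => u; rewrite !ffunE.
  have -> : expect (c *: F + G) = c * expect F + expect G.
    by rewrite -expectZ -expectD; apply: eq_expect => v; rewrite !ffunE.
  have -> : laplacian (c *: F + G) u = c * laplacian F u + laplacian G u.
    rewrite -expect_inZ -expect_inD; apply: eq_expect_in => t _.
    by rewrite !ffunE /GRing.scale /=; ring.
  by rewrite /GRing.scale /=; ring.
have Lexpect (F : {ffun U_ n kappa -> R^o}) : expect (L F) = expect F.
  rewrite (eq_expect (G := fun u => laplacian F u + expect F)) => [|u].
    by rewrite expectD expect_laplacian expect_cst // add0r.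
  by rewrite ffunE.
have L_inj F : L F = 0 -> F = 0.
  move=> LF0; have EF0 : expect F = 0.
    rewrite -Lexpect LF0 (eq_expect (G := fun=> 0)) => [|u]; rewrite ?ffunE //.
    exact: expect_cst.
  have lapF u : laplacian F u = 0.
    have := congr1 (fun G : {ffun _ -> R^o} => G u) LF0.
    by rewrite !ffunE EF0 addr0.
  have := log_sobolev_Poincare F; rewrite dirichletE.
  rewrite (eq_expect (G := fun=> 0)) => [|u]; last by rewrite lapF mulr0.
  rewrite expect_cst // mulr0 pmulr_rle0 // variance_sqr // EF0 expr0n subr0.
  move=> F2_le0; have F2_eq0 : expect (fun u => F u ^+ 2) = 0.
    by apply/eqP; rewrite eq_le F2_le0 expect_ge0 // => u; exact: sqr_ge0.
  by apply/ffunP => u; rewrite (expect_sqr_eq0 F2_eq0) ffunE.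
have [F LF] := injective_linear_surj Llin L_inj [ffun u => f u - expect f].
(* The Laplacian and f - E[f] both have mean zero, so the added term E[F] drops out. *)
have EF0 : expect F = 0.
  rewrite -Lexpect LF (eq_expect (G := fun u => f u - expect f)) => [|u].
    by rewrite expectB expect_cst // subrr.
  by rewrite ffunE.
exists F => u; have := congr1 (fun G : {ffun _ -> R^o} => G u) LF.
by rewrite !ffunE EF0 addr0.
Qed.

(** * The contribution of a single transposition *)

Section Influence.
Variables (f F : U_ n kappa -> R) (t : 'S_n).
Hypothesis f01 : forall u, f u = 0 \/ f u = 1.
Hypothesis tT : t \in Trans n.
Hypothesis lapF : forall u, laplacian F u = f u - expect f.

Let g u := f u - f (act u t).
Let h u := F u - F (act u t).
Let a := expect (fun u => g u ^+ 2).

Lemma influence_derivative : a = 2 * influence t f.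
Proof. by rewrite /influence mulrA divff ?mul1r ?pnatr_eq0. Qed.

Lemma derivative_range u : g u ^+ 2 = 0 \/ g u ^+ 2 = 1.
Proof.
by rewrite /g; case: (f01 u) => ->; case: (f01 (act u t)) => ->;
  [left|right|right|left]; ring.
Qed.

Lemma influence_ge0 : 0 <= influence t f.
Proof.
by apply: mulr_ge0; rewrite ?invr_ge0 ?expect_ge0 // => u; exact: sqr_ge0.
Qed.

Lemma influence_le : influence t f <= 2^-1.
Proof.
have [T0|T_gt0] := posnP #|{: U_ n kappa}|.
  by rewrite /influence /expect T0 invr0 !mulr0 invr_ge0.
rewrite -[leRHS]mulr1 ler_wpM2l ?invr_ge0 // -[leRHS](expect_cst _ T_gt0).
by apply: le_expect => u; rewrite -/(g u); case: (derivative_range u) => ->.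
Qed.

Lemma laplacian_derivative u : laplacian h u = g u.
Proof.
transitivity (laplacian F u - laplacian F (act u t)).
  rewrite -laplacian_act -mulN1r -expect_inZ -expect_inD.
  by apply: eq_expect_in => s _; rewrite /h; ring.
by rewrite !lapF /g; ring.
Qed.

Lemma expect_derivative : expect h = 0.
Proof. by rewrite expectB (expect_reindex F (@act_inj n l kappa t)) subrr. Qed.

Lemma dirichlet_derivative : dirichlet h = 2 * expect (fun u => g u * h u).
Proof.
rewrite dirichletE; congr (_ * _); apply: eq_expect => u.
by rewrite laplacian_derivative mulrC.
Qed.

Lemma ln2_le1 : ln (2 : R) <= 1.
Proof. by rewrite -[2]/(1 + 1); apply: le_ln1Dx; lra. Qed.

(* [h = L^-1 g], so [E[g h] = <h, L h>], and Cauchy-Schwarz on the support of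
   [g] gives [E[g h]^2 <= a E[h^2 g^2]] since [g^3 = g]. The entropy inequality
   with test function [ln(1/a) g^2] bounds [E[h^2 g^2]] by
   [O(<h, L h> / (r ln(1/a)))]; the Poincare inequality absorbs the error term
   and replaces [ln(1/a)], which vanishes at [a = 1], by [ln(4/a)]. *)
Lemma influence_bound :
  expect (fun u => g u * h u) <=
  16 / (r * ln 2) * (influence t f / log2 (2 / influence t f)).
Proof.
set X := expect _; set I := influence t f.
have I_ge0 : 0 <= I := influence_ge0.
have aE : a = 2 * I := influence_derivative.
have [I0|I_neq0] := eqVneq I 0.
  rewrite I0 mul0r mulr0.
  have g0 : forall u, g u = 0 by apply: expect_sqr_eq0; rewrite -/a aE I0 mulr0.
  rewrite /X (eq_expect (G := fun u => 0 * h u)) => [|u]; last by rewrite g0.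
  by rewrite expectZ mul0r.
have I_gt0 : 0 < I by rewrite lt_def I_neq0.
have T_gt0 : (0 < #|{: U_ n kappa}|)%N.
  rewrite lt0n; apply/eqP => T0; move: I_neq0.
  by rewrite /I /influence /expect T0 invr0 !mulr0 eqxx.
have a_gt0 : 0 < a by rewrite aE mulr_gt0.
have a_le1 : a <= 1 by have := influence_le; rewrite aE -/I; lra.
set K := ln (2 / I).
pose m := expect (fun u => h u ^+ 2).
pose B := expect (fun u => h u ^+ 2 * g u ^+ 2).
have D_X : dirichlet h = 2 * X := dirichlet_derivative.
have X_ge0 : 0 <= X by have := dirichlet_ge0 h; rewrite D_X; lra.
have B_ge0 : 0 <= B by apply: expect_ge0 => u; rewrite mulr_ge0 ?sqr_ge0.
have B_le : B <= m.
  apply: le_expect => u; rewrite ler_piMr ?sqr_ge0 //.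
  by case: (derivative_range u) => ->.
(* That is, K = ln (4 / a), since a = 2 I. *)
have KE : K = 2 * ln 2 - ln a.
  rewrite /K lnM ?posrE ?invr_gt0 // lnV ?posrE // aE lnM ?posrE //; ring.
have ln2_gt0 : 0 < ln (2 : R) by rewrite ln_gt0 // ltr1n.
have K_gt0 : 0 < K by have := ln_le0 a_le1; rewrite KE; lra.
have Poincare : r * m <= 2 * X.
  have := log_sobolev_Poincare h.
  by rewrite variance_sqr // expect_derivative expr0n subr0 D_X.
have entropy : r * (- ln a * B - m) <= 2 * X.
  have := @log_sobolev_Young h (fun u => - ln a * g u ^+ 2); rewrite D_X.
  rewrite (eq_expect (F := fun u => h u ^+ 2 * _)
    (G := fun u => - ln a * (h u ^+ 2 * g u ^+ 2))); last by move=> u; ring.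
  rewrite expectZ -/m -/B; apply.
  (* The exponential is 1 where g = 0 and 1/a elsewhere; the majorant has mean 2 because E[g^2] =
     a. *)
  apply: (@le_trans _ _ (expect (fun u => 1 + a^-1 * g u ^+ 2))).
    apply: le_expect => u; case: (derivative_range u) => ->.
      by rewrite !mulr0 expR0 addr0.
    by rewrite !mulr1 expRN lnK ?posrE // lerDr.
  by rewrite expectD expect_cst // expectZ -/a mulVf ?gt_eqF.
(* The part -ln a of K costs 2 X + r m <= 4 X, and the part 2 ln 2 costs 2 r m <= 4 X. *)
have rKB : r * K * B <= 8 * X.
  have : r * (ln 2 * B) <= r * m.
    rewrite ler_pM2l //; apply: le_trans B_le; rewrite ler_piMl //.
    exact: ln2_le1.
  by rewrite KE; lra.
have CS : X ^+ 2 <= a * B.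
  rewrite /X (eq_expect (G := fun u => g u * (h u * g u ^+ 2))) => [|u];
    last first.
    case: (derivative_range u) => e; rewrite e; last by rewrite mulr1.
    by move/eqP: e; rewrite sqrf_eq0 => /eqP ->; rewrite !mul0r.
  apply: le_trans (Cauchy_Schwarz_expect _ _) _; rewrite -/a ler_pM2l //.
  apply: le_expect => u; rewrite exprMn ler_wpM2l ?sqr_ge0 //.
  by case: (derivative_range u) => ->; rewrite ?expr0n ?expr1n.
have -> : 16 / (r * ln 2) * (I / log2 (2 / I)) = 16 * I / (r * K).
  by rewrite /log2 -/K; field; rewrite !gt_eqF.
rewrite ler_pdivlMr ?mulr_gt0 //.
have [->|X_neq0] := eqVneq X 0; first by rewrite mul0r mulr_ge0.
have X_gt0 : 0 < X by rewrite lt_def X_neq0.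
(* After multiplication by X: X^2 r K <= a B r K <= 8 a X = 16 I X. *)
rewrite -(ler_pM2l X_gt0) mulrA -expr2.
apply: (@le_trans _ _ (a * B * (r * K))); first by rewrite ler_pM2r ?mulr_gt0.
have := ler_wpM2l (ltW a_gt0) rKB; rewrite aE; lra.
Qed.

End Influence.

(** Averages the bound on E[g h] over transpositions; the factor 1/2 from symmetrization turns 16
    into 8. *)
Lemma log_sobolev_Talagrand (f : U_ n kappa -> R) :
  (forall u, f u = 0 \/ f u = 1) ->
  r * ln 2 / 8 * variance f <= expect_in (Trans n) (fun t =>
    influence t f / log2 (2 / influence t f)).
Proof.
move=> f01; have [F lapF] := Poisson_equation f.
have ln2_gt0 : 0 < ln (2 : R) by rewrite ln_gt0 // ltr1n.
(* One factor f - E[f] is L F, and E[L F] = 0 removes the constant from the other. *)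
have varE : variance f = expect (fun u => f u * laplacian F u).
  have := expect_laplacian F => lap0.
  rewrite -[RHS]subr0 -[X in _ - X](mulr0 (expect f)) -lap0 -expectZ -expectB.
  by apply: eq_expect => u; rewrite lapF; ring.
rewrite varE expect_mul_laplacian.
set S := expect_in _ _; set S' := expect_in _ _.
have : S <= 16 / (r * ln 2) * S'.
  rewrite -expect_inZ; apply: le_expect_in => t tT.
  exact: influence_bound.
have c_gt0 : 0 < r * ln 2 / 16 by rewrite divr_gt0 ?mulr_gt0.
rewrite -(ler_pM2l c_gt0).
have -> : r * ln 2 / 16 * (16 / (r * ln 2) * S') = S' by field; rewrite !gt_eqF.
lra.
Qed.

End LogSobolev.

(* A summand with influence 0 is 0 / _ = 0, as required. *)
Theorem theorem4p1 (R : realType) :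
  exists c : R, 0 < c /\
    forall (l n : nat) (kappa : 'I_l -> nat) (f : U_ n kappa -> R),
      (2 <= l)%N ->
      (forall i, (0 < kappa i)%N) ->
      (\sum_(i < l) kappa i)%N = n ->
      (forall u, f u = 0 \/ f u = 1) ->
      ('C(n, 2)%:R)^-1 *
        (\sum_(tau in Trans n)
           influence tau f / log2 (2 / influence tau f))
      >= c * log_sobolev R n kappa * variance f.
Proof.
have ln2_gt0 : 0 < ln (2 : R) by rewrite ln_gt0 // ltr1n.
(* Half of ln 2 / 8, as the bound is applied with some r > rho / 2. *)
exists (ln 2 / 16); split; first by rewrite divr_gt0.
move=> l n kappa f _ _ _ f01.
rewrite [leRHS]mulrC -card_Trans.
set S := expect_in (Trans n) (fun t => influence t f / log2 (2 / influence t f)).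
rewrite -/S; set rho := log_sobolev R n kappa.
have var_ge0 : 0 <= variance f by apply: expect_ge0 => u; exact: sqr_ge0.
(* If rho <= 0 the lower bound is nonpositive, while each summand is nonnegative because influences
   are at most 1/2. *)
have [rho_le0|rho_gt0] := leP rho 0.
  apply: (@le_trans _ _ 0).
    by rewrite mulr_le0_ge0 // mulr_ge0_le0 // divr_ge0 // ltW.
  rewrite divr_ge0 ?ler0n // sumr_ge0 // => t tT.
  have I_ge0 := influence_ge0 f t; have I_le := influence_le t f01.
  have [->|I_neq0] := eqVneq (influence t f) 0; first by rewrite mul0r.
  rewrite divr_ge0 // divr_ge0 ?(ltW ln2_gt0) // ln_ge0 //.
  by rewrite ler_pdivlMr ?lt_def ?I_neq0 // mul1r (le_trans I_le) //; lra.
(* Otherwise [sup] takes its default value 0, against rho > 0. *)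
have rho_sup : has_sup [set r | log_sobolev_ineq (R := R) n kappa r]%classic.
  apply: boolp.contrapT => /sup_out rho0.
  by move: rho_gt0; rewrite /rho /log_sobolev rho0 ltxx.
(* An admissible r within rho / 2 of the supremum avoids showing that it is attained. *)
have [r LS] := sup_adherent (divr_gt0 rho_gt0 (ltr0n R 2)) rho_sup.
rewrite -/(log_sobolev R n kappa) -/rho => r_gt.
have r_gt0 : 0 < r by lra.
apply: le_trans (log_sobolev_Talagrand r_gt0 LS f01).
rewrite ler_wpM2r //; have : 0 <= (r - rho / 2) * ln 2.
  by rewrite mulr_ge0 ?(ltW ln2_gt0) //; lra.
lra.
Qed.
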